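(* Let $G=(V,E)$ be a finite directed graph and $w:E\to\mathbb R$ a real weight function on its arcs. Let \[ P(G,w)=\Big\{y\in\mathbb R^E :\ \sum_{v:(u,v)\in E}y_{uv}-\sum_{v:(v,u)\in E}y_{vu}=0\ \ \forall u\in V,\quad \sum_{(u,v)\in E}w_{uv}y_{uv}=-1,\quad y_{uv}\ge 0\ \ \forall (u,v)\in E\Big\}. \] Then: (1) The set of vertices of $P(G,w)$ is \[ \Big\{\tfrac{-1}{w(C)}\,\chi(C) :\ C\in\mathcal C^-(G,w)\Big\}. \] (2) The set of extreme directions of $P(G,w)$, each normalized so that its coordinates sum to $1$, equals $\mathcal D_1\cup\mathcal D_2$, where \[ \mathcal D_1=\Big\{\tfrac{1}{|C|}\chi(C):\ C\in\mathcal C^0(G,w)\Big\}, \] \[ \mathcal D_2=\Big\{\mu_{C_1,C_2}\,\chi(C_1)+\mu'_{C_1,C_2}\,\chi(C_2):\ (C_1,C_2)\text{ is a 2-cycle}\Big\}, \] with \[ \mu_{C_1,C_2}=\frac{w(C_2)}{w(C_2)|C_1|-w(C_1)|C_2|},\qquad \mu'_{C_1,C_2}=\frac{-w(C_1)}{w(C_2)|C_1|-w(C_1)|C_2|} \] (these are non-negative numbers).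
   Context: All cycles are directed simple cycles, and a cycle $C$ is identified with its set of arcs; $|C|$ is its number of arcs. For $X\subseteq E$, $w(X)=\sum_{e\in X}w_e$ and $\chi(X)\in\{0,1\}^E$ is the characteristic vector of $X$. $\mathcal C^-(G,w)$, $\mathcal C^+(G,w)$, $\mathcal C^0(G,w)$ denote the families of directed cycles of $G$ of negative, positive, and zero total weight, respectively. A 2-cycle is a pair $(C_1,C_2)$ with $C_1\in\mathcal C^-(G,w)$, $C_2\in\mathcal C^+(G,w)$, such that the arc set $C_1\cup C_2$ contains no directed cycle of $G$ other than $C_1$ and $C_2$. A vertex of a polyhedron $P$ is a point of $P$ that is not a convex combination $\lambda v_1+(1-\lambda)v_2$, $\lambda\in(0,1)$, of two other points $v_1,v_2\in P$. A direction of $P$ is a vector $d$ with $x_0+\mu d\in P$ for all $x_0\in P$, $\mu\ge0$; an extreme direction is a direction that is not a conic combination of two other (non-proportional) directions.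
   Formalization: Part (2) is stated only for non-empty P(G,w) (i.e. G has a negative cycle): for empty P every vector is a direction under the given definition, and the claim fails, e.g. for two opposite arcs of weight 0. *)

(* Defs.v *)
From HB Require Import structures.
From mathcomp Require Import all_boot all_order all_algebra.
From mathcomp Require Import boolp classical_sets reals.

Set Implicit Arguments.
Unset Strict Implicit.
Unset Printing Implicit Defensive.

Import Order.TTheory GRing.Theory Num.Theory.
Local Open Scope ring_scope.
Local Open Scope classical_set_scope.

Section Polyhedra.
Variables (R : realType) (U : lmodType R).
Implicit Types (P : set U) (x d u v : U).

Definition vertices P : set U :=
  [set x | P x /\
    ~ exists v1 v2 (l : R),
        [/\ P v1 /\ v1 <> x, P v2 /\ v2 <> x, 0 < l < 1
          & x = l *: v1 + (1 - l) *: v2]].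

(* If [P] is empty then every vector is a direction of [P]. *)
Definition is_direction P d : Prop :=
  forall x (m : R), P x -> 0 <= m -> P (x + m *: d).

Definition proportional u v : Prop :=
  exists t : R, u = t *: v \/ v = t *: u.

(* Conic combinations may have zero coefficients, so "other directions" must  *)
(* mean directions not proportional to [d]: otherwise d = 1/2 (2 d) + 0 d2    *)
(* would disqualify every [d].  The zero vector spans no ray and is excluded. *)
Definition extreme_directions P : set U :=
  [set d | [/\ is_direction P d, d <> 0 &
    ~ exists d1 d2 (a b : R),
        [/\ is_direction P d1 /\ is_direction P d2,
            [/\ ~ proportional d1 d, ~ proportional d2 d
              & ~ proportional d1 d2],
            0 <= a, 0 <= b & d = a *: d1 + b *: d2]]].

End Polyhedra.

(* Digraphs have no parallel arcs, but may have loops and opposite arcs. *)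
Definition darc (V : finType) (E : {set V * V}) : finType :=
  {e : V * V | e \in E}.

Section Digraph.
Variables (V : finType) (E : {set V * V}).

Definition src (e : darc E) : V := (val e).1.
Definition tgt (e : darc E) : V := (val e).2.

(* [p] lists the vertices of the cycle in order; a loop is a cycle with one   *)
(* arc, and a pair of opposite arcs is a cycle with two arcs.                 *)
Definition is_cycle (C : {set darc E}) : Prop :=
  exists p : seq V,
    [/\ p <> [::], ucycle (fun u v => (u, v) \in E) p
      & C = [set e | (src e \in p) && (tgt e == next p (src e))]%SET].

Variable R : realType.

Variable w : darc E -> R.

Definition arcs_weight (C : {set darc E}) : R := \sum_(e in C) w e.

(* Vectors of R^E have codomain [R^o] so that they form a module over [R]. *)
Definition chi (C : {set darc E}) : {ffun darc E -> R^o} :=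
  [ffun e => (e \in C)%:R].

Definition neg_cycle C : Prop := is_cycle C /\ arcs_weight C < 0.
Definition pos_cycle C : Prop := is_cycle C /\ 0 < arcs_weight C.
Definition zero_cycle C : Prop := is_cycle C /\ arcs_weight C = 0.

Definition two_cycle (C1 C2 : {set darc E}) : Prop :=
  [/\ neg_cycle C1, pos_cycle C2 &
    forall C, is_cycle C -> C \subset C1 :|: C2 -> C = C1 \/ C = C2].

Definition neg_cycle_polyhedron : set {ffun darc E -> R^o} :=
  [set y | [/\ forall u : V,
                 \sum_(e | src e == u) y e - \sum_(e | tgt e == u) y e = 0,
               \sum_e w e * y e = -1
             & forall e, 0 <= y e]].

Definition normalize (d : {ffun darc E -> R^o}) : {ffun darc E -> R^o} :=
  (\sum_e d e)^-1 *: d.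

Definition mu1 (C1 C2 : {set darc E}) : R :=
  arcs_weight C2 / (arcs_weight C2 * #|C1|%:R - arcs_weight C1 * #|C2|%:R).
Definition mu2 (C1 C2 : {set darc E}) : R :=
  - arcs_weight C1 / (arcs_weight C2 * #|C1|%:R - arcs_weight C1 * #|C2|%:R).

Definition D1 : set {ffun darc E -> R^o} :=
  [set (#|C|%:R)^-1 *: chi C | C in zero_cycle].

Definition D2 : set {ffun darc E -> R^o} :=
  [set y | exists C1 C2, two_cycle C1 C2 /\
             y = mu1 C1 C2 *: chi C1 + mu2 C1 C2 *: chi C2].

End Digraph.

(* Main.v *)
Require Import Defs.
From mathcomp Require Import all_boot all_order all_algebra.
From mathcomp Require Import lra.
From mathcomp Require Import boolp classical_sets reals.

Set Implicit Arguments.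
Unset Strict Implicit.
Unset Printing Implicit Defensive.

Import Order.TTheory GRing.Theory Num.Theory.
Local Open Scope ring_scope.
Local Open Scope classical_set_scope.

(** A point of [P] is a vertex iff it is the only point of [P] supported in its
support, and a vector of the recession cone spans an extreme ray iff every vector
of the cone supported in its support is a multiple of it: otherwise one can
subtract a small multiple of the other vector without leaving the orthant. A
nonnegative circulation is a conic combination of the cycles of its support, and
a circulation supported in a single cycle is a multiple of its characteristic
vector. So the support of a vertex contains a negative cycle, whose associated
point of [P] must be that vertex. The support of an extreme direction contains
either a zero cycle or both a negative cycle [C1] and a positive cycle [C2]; in
the latter case the direction is a multiple of the zero-weight combination of
[chi C1] and [chi C2]. A third cycle in the union of [C1] and [C2] would yield
another such combination, hence a linear relation between three distinct cycles,
which cannot exist since cycles are incomparable for inclusion. *)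

(** * Circulations, weights and supports *)

Section Circulations.
Variables (R : realType) (V : finType) (E : {set V * V}) (w : darc E -> R).
Local Notation vec := {ffun darc E -> R^o}.
Local Notation P := (neg_cycle_polyhedron w).
Implicit Types (x y z d : vec) (C : {set darc E}) (u : V) (e : darc E).

Definition supp y : {set darc E} := [set e | y e != 0]%SET.

Definition outflow y u : R := \sum_(e | src e == u) y e.
Definition inflow y u : R := \sum_(e | tgt e == u) y e.
Definition circulation y : Prop := forall u, outflow y u - inflow y u = 0.
Definition weight y : R := \sum_e w e * y e.
Definition nonneg y : Prop := forall e, 0 <= y e.

Definition recession_cone : set vec :=
  [set d | [/\ circulation d, weight d = 0 & nonneg d]].

Lemma circulation_lin (a b : R) x y :
  circulation x -> circulation y -> circulation (a *: x + b *: y).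
Proof.
move=> cx cy u.
rewrite (_ : 0 = a * (outflow x u - inflow x u) + b * (outflow y u - inflow y u)).
  rewrite /outflow /inflow.
  under eq_bigr do rewrite !ffunE.
  under [X in _ - X]eq_bigr do rewrite !ffunE.
  by rewrite !big_split -!scaler_sumr /= /GRing.scale /=; lra.
by rewrite cx cy !mulr0 addr0.
Qed.

Lemma weight_lin (a b : R) x y :
  weight (a *: x + b *: y) = a * weight x + b * weight y.
Proof.
rewrite /weight !mulr_sumr -big_split; apply: eq_bigr => e _.
by rewrite !ffunE /= /GRing.scale /=; lra.
Qed.

Lemma nonneg_lin (a b : R) x y :
  0 <= a -> 0 <= b -> nonneg x -> nonneg y -> nonneg (a *: x + b *: y).
Proof.
by move=> a0 b0 x0 y0 e; rewrite !ffunE addr_ge0// mulr_ge0.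
Qed.

Lemma weight_chi C : weight (chi R C) = arcs_weight w C.
Proof.
rewrite /weight /arcs_weight [RHS]big_mkcond; apply: eq_bigr => e _.
by rewrite ffunE; case: ifP => _; rewrite ?mulr1 ?mulr0.
Qed.

Lemma supp_chi C : supp (chi R C) = C.
Proof. by apply/setP => e; rewrite inE ffunE pnatr_eq0; case: (_ \in _). Qed.

Lemma chi_ge0 C : nonneg (chi R C).
Proof. by move=> e; rewrite ffunE ler0n. Qed.

Lemma suppZ (t : R) x : t != 0 -> supp (t *: x) = supp x.
Proof. by move=> t0; apply/setP => e; rewrite !inE ffunE mulf_eq0 (negPf t0). Qed.

Lemma arc_unique p e e' : src e = src e' ->
  tgt e = next p (src e) -> tgt e' = next p (src e') -> e = e'.
Proof.
move=> se te te'; apply: val_inj; rewrite [val e]surjective_pairing.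
by rewrite [val e']surjective_pairing; congr pair; rewrite // [LHS]te se -te'.
Qed.

(** * Circulations supported in one cycle *)

Section Cycle.
Variable p : seq V.
Let C := [set e : darc E | (src e \in p) && (tgt e == next p (src e))]%SET.
Hypothesis ucp : ucycle (fun u v => (u, v) \in E) p.

Let up : uniq p. Proof. by case/andP: ucp. Qed.

(** By injectivity of [next p], an arc of [C] enters [next p u] exactly when it leaves [u], so the
    two sums agree term by term. *)
Lemma inflow_next y u : supp y \subset C -> inflow y (next p u) = outflow y u.
Proof.
move=> /fintype.subsetP sy; rewrite /inflow /outflow big_mkcond [RHS]big_mkcond /=.
apply: eq_bigr => e _; have [->|ye0] := eqVneq (y e) 0; first by rewrite !if_same.
have := sy e; rewrite !inE => /(_ ye0)/andP[_ /eqP ->].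
by rewrite (inj_eq (can_inj (prev_next up))).
Qed.

Lemma outflow_cycle y e : supp y \subset C -> e \in C -> outflow y (src e) = y e.
Proof.
move=> /fintype.subsetP sy eC; rewrite /outflow (bigD1 e)//= big1 ?addr0// => e'.
case/andP => /eqP se' ne; apply/eqP; apply: contraNT ne => ye'.
have := sy e'; rewrite inE => /(_ ye'); move: eC; rewrite !inE.
move=> /andP[_ /eqP te] /andP[_ /eqP te']; apply/eqP.
exact: arc_unique te' te.
Qed.

Lemma outflow_chi u : outflow (chi R C) u = (u \in p)%:R.
Proof.
have [upp|upp] := boolP (u \in p); last first.
  rewrite /outflow big1// => e /eqP se.
  by rewrite ffunE inE se (negPf upp).
have arcE : (u, next p u) \in E by case/andP: ucp => cp _; exact: next_cycle cp upp.
pose e : darc E := Sub (u, next p u) arcE.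
have se : src e = u by rewrite /src /= .
have eC : e \in C by rewrite inE se upp /tgt /=.
by rewrite -{1}se outflow_cycle ?supp_chi// ffunE eC.
Qed.

Lemma circulation_chi_seq : circulation (chi R C).
Proof.
move=> u; rewrite -{2}(next_prev up u) inflow_next ?supp_chi//.
by rewrite !outflow_chi mem_prev subrr.
Qed.

(** Conservation at [next p u] makes the outflow invariant under [next p], hence constant on the
    cycle; at the source of an arc of [C] the outflow is the value of [y] on that arc. *)
Lemma circulation_on_cycle_seq y : circulation y -> supp y \subset C ->
  exists t : R, y = t *: chi R C.
Proof.
move=> cy sy.
have [y0|[e0]] := set_0Vmem (supp y).
  exists 0; rewrite scale0r; apply/ffunP => e; rewrite ffunE.
  by move/setP/(_ e): y0; rewrite !inE => /negbFE/eqP.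
move=> /(fintype.subsetP sy) e0C.
have stepO u : outflow y (next p u) = outflow y u.
  by rewrite -(inflow_next u sy); apply/eqP; rewrite -subr_eq0 cy.
have iterO k u : outflow y (iter k (next p) u) = outflow y u.
  by elim: k => //= k IH; rewrite stepO.
have conn u v : u \in p -> v \in p -> outflow y u = outflow y v.
  move=> u_p v_p; have : fconnect (next p) u v.
    by rewrite (fconnect_cycle (cycle_next up)).
  by move=> /iter_findex <-; rewrite iterO.
exists (y e0); apply/ffunP => e; rewrite !ffunE /GRing.scale /=.
have [eC|eC] := boolP (e \in C); last first.
  by rewrite mulr0; apply/eqP; apply: contraNT eC => ye; rewrite (fintype.subsetP sy)// inE.
rewrite mulr1 -(outflow_cycle sy eC) -(outflow_cycle sy e0C).
by apply: conn; [move: eC|move: e0C]; rewrite inE => /andP[].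
Qed.

End Cycle.

Lemma circulation_chi C : is_cycle C -> circulation (chi R C).
Proof. by case=> p [_ ucp ->]; exact: circulation_chi_seq. Qed.

Lemma circulation_on_cycle C y : is_cycle C -> circulation y ->
  supp y \subset C -> exists t : R, y = t *: chi R C.
Proof. by case=> p [_ ucp ->]; exact: circulation_on_cycle_seq. Qed.

Lemma cycle_neq0 C : is_cycle C -> C != finset.set0.
Proof.
case=> -[[]|u p [_ ucp ->]]; first by []; apply/eqP => C0.
have := outflow_chi ucp u; rewrite C0 mem_head /outflow big1.
  by move/eqP; rewrite eq_sym oner_eq0.
by move=> e _; rewrite ffunE inE.
Qed.

(** The vector [chi R C] is a circulation supported in [C'], so it is a nonzero multiple of
    [chi R C'] and has the same support. *)
Lemma cycle_subset_eq C C' : is_cycle C -> is_cycle C' -> C \subset C' -> C = C'.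
Proof.
move=> cC cC' sCC'.
have [t tE] : exists t : R, chi R C = t *: chi R C'.
  by apply: circulation_on_cycle cC' _ _; rewrite ?supp_chi//; exact: circulation_chi.
have t0 : t != 0.
  apply: contra_neq (cycle_neq0 cC) => t0; rewrite -(supp_chi C) tE t0 scale0r.
  by apply/setP => e; rewrite !inE ffunE eqxx.
by rewrite -(supp_chi C) tE suppZ// supp_chi.
Qed.

(** * Decomposition of nonnegative circulations into cycles *)

Lemma cycle_in_support y : circulation y -> nonneg y -> supp y != finset.set0 ->
  exists2 C, is_cycle C & C \subset supp y.
Proof.
move=> cy y0 /set0Pn[e0 e0y].
(* Walk along chosen support arcs: [f] follows the arc [out u]. By conservation a vertex entered by
   a support arc is also left by one, so from the source of [e0] the default value [u] of [f] is
   never taken. *)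
pose out u := [pick e | (src e == u) && (y e != 0)].
pose f u := if out u is Some e then tgt e else u.
have outI e : y e != 0 -> out (src e).
  by rewrite /out; case: pickP => // /(_ e) /=; rewrite eqxx /= => ->.
have outP u : out u -> exists e, [/\ src e = u, y e != 0 & f u = tgt e].
  rewrite /f; case outE: (out u) => [e|]// _; exists e.
  by move: outE; rewrite /out; case: pickP => // e' /andP[/eqP ? ?] [<-].
have out_step u : out u -> out (f u).
  move=> /outP[e [_ ye ->]].
  have : outflow y (tgt e) != 0.
    have /eqP := cy (tgt e); rewrite subr_eq0 => /eqP ->; apply: lt0r_neq0.
    by rewrite /inflow (bigD1 e)//= ltr_wpDr ?sumr_ge0// lt_def ye y0.
  apply: contraNT => noout; rewrite /outflow big1// => e' /eqP se'.
  by apply/eqP; apply: contraNT noout => /outI; rewrite se'.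
have out_iter k u : out u -> out (iter k f u).
  by move=> ou; elim: k => //= k IH; exact: out_step.
have out0 : out (src e0) by apply: outI; rewrite inE in e0y.
(* The vertex set being finite, the walk returns to its vertex of some index [i], whose orbit is
   then periodic. The criterion used asks for an iterate of index [k.+1], hence the predecessor in
   the witness. *)
have [z oz fz] : exists2 z, out z & fcycle f (orbit f z).
  have /trajectP[i ilt iE] := looping_order f (src e0).
  exists (iter i f (src e0)); first exact: out_iter.
  apply/(orbitPcycle 0 3); exists (order f (src e0) - i).-1%N.
  by rewrite prednK ?subn_gt0// -iterD subnK// ltnW.
have outz u : u \in orbit f z -> out u.
  by rewrite -fconnect_orbit => /iter_findex <-; exact: out_iter.
exists [set e | (src e \in orbit f z) && (tgt e == next (orbit f z) (src e))]%SET.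
  exists (orbit f z); split => //; first by have := in_orbit f z; case: orbit.
  rewrite /ucycle orbit_uniq andbT; apply: cycle_from_next (orbit_uniq _ _) _.
  move=> u uz; rewrite (nextE fz)//; have [e [<- _ ->]] := outP _ (outz _ uz).
  by rewrite -surjective_pairing; exact: valP.
(* An arc is determined by its ends, so each arc of the cycle is the support arc chosen at its
   source. *)
apply/fintype.subsetP => e; rewrite !inE => /andP[sez /eqP te].
have [e' [se' ye' fe']] := outP _ (outz _ sez).
by rewrite (arc_unique (esym se') te) ?se' // (nextE fz).
Qed.

(** Induction on the size of the support: subtract from [y] a cycle of its support, scaled by the
    least value of [y] on it. The result stays nonnegative and vanishes on a minimizing arc. *)
Lemma cycle_decomposition y : circulation y -> nonneg y ->
  exists c : {set darc E} -> R,
    [/\ forall C, 0 <= c C, forall C, c C != 0 -> is_cycle C /\ C \subset supp y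
      & y = \sum_C c C *: chi R C].
Proof.
have [n] := ubnP #|supp y|; elim: n y => // n IH y yn cy y0.
have [sy0|syN0] := eqVneq (supp y) finset.set0.
  exists (fun=> 0); split=> // [C|]; first by rewrite eqxx.
  rewrite big1 => [|C _]; last by rewrite scale0r.
  by apply/ffunP => e; rewrite ffunE; move/setP/(_ e): sy0; rewrite !inE => /negbFE/eqP.
have [C cC sC] := cycle_in_support cy y0 syN0.
have [e1 e1C] := set0Pn _ (cycle_neq0 cC).
have [e eCm emin] := arg_minP (fun e => y e : R) e1C.
have {eCm} eC : e \in C := eCm.
have ye0 : y e != 0 by have /(fintype.subsetP sC) := eC; rewrite inE.
pose y' := 1 *: y + (- y e) *: chi R C.
have y'E e' : y' e' = y e' - (if e' \in C then y e else 0) :> R.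
  rewrite !ffunE /GRing.scale /= mul1r.
  by case: ifP => _; rewrite ?mulr1 ?mulr0 ?oppr0 ?mulNr ?mulr1.
have y'0 : nonneg y'.
  move=> e'; rewrite y'E; case: ifP => [e'C|_]; rewrite ?subr0// subr_ge0.
  exact: emin.
have sy' : supp y' \subset supp y.
  apply/fintype.subsetP => e'; rewrite !inE y'E; case: ifP => [/(fintype.subsetP sC)|_].
    by rewrite inE.
  by rewrite subr0.
have [||c [c0 cs yc]] := IH y' _ _ y'0.
- rewrite ltnS in yn; apply: leq_trans yn; apply: proper_card.
  apply/fintype.properP; split=> //; exists e; first by rewrite inE.
  by rewrite inE y'E eC subrr eqxx.
- by apply: circulation_lin cy _; exact: circulation_chi.
exists (fun C' => c C' + (if C' == C then y e : R else 0)); split=> [C'|C'|].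
- by rewrite addr_ge0//; case: ifP => // _; exact: y0.
- case: (C' =P C) => [-> _|_]; [by split|]; rewrite addr0 => /cs[cC' sC']; split => //.
  exact: fintype.subset_trans sC' sy'.
under eq_bigr do rewrite scalerDl; rewrite big_split /= -yc.
rewrite (bigD1 C)//= eqxx big1 ?addr0 /y'; last first.
  by move=> C' /negPf ->; rewrite scale0r.
by rewrite scale1r scaleNr subrK.
Qed.

(** * Support criteria for vertices and extreme directions *)

Lemma supp_gt0 x e : nonneg x -> e \in supp x -> 0 < x e.
Proof. by move=> x0; rewrite inE lt_def => ->; rewrite x0. Qed.

Lemma supp_summand (a b : R) x y : 0 < a -> 0 <= b -> nonneg x -> nonneg y ->
  supp x \subset supp (a *: x + b *: y).
Proof.
move=> a0 b0 x0 y0; apply/fintype.subsetP => e ex; rewrite inE !ffunE.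
apply: lt0r_neq0; rewrite ltr_pwDl//; last exact: mulr_ge0.
by apply: mulr_gt0 => //; exact: supp_gt0.
Qed.

Lemma nonneg_perturb x y : nonneg x -> nonneg y -> supp x \subset supp y ->
  exists2 r : R, 0 < r < 1 & nonneg (1 *: y + (- r) *: x).
Proof.
move=> x0 y0 /fintype.subsetP sxy.
(* [S] bounds every ratio [x e / y e], so any step below its inverse is small enough; adding 2 keeps
   the step below 1 and defined when [S] is 0. Where [y e] is 0 the quotient is 0 by convention. *)
pose S : R := \sum_e x e / y e.
have S0 : 0 <= S by apply: sumr_ge0 => e _; rewrite divr_ge0.
exists (2 + S)^-1 => [|e].
  by rewrite invr_gt0 invf_lt1; lra.
rewrite !ffunE /GRing.scale /= mul1r mulNr subr_ge0 mulrC ler_pdivrMr; last lra.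
have [->|xe] := eqVneq (x e) 0; first by rewrite mulr_ge0//; lra.
have ye : 0 < y e by apply: supp_gt0 => //; rewrite sxy ?inE.
rewrite mulrC -ler_pdivrMr//.
have : x e / y e <= S.
  rewrite /S (bigD1 e)//= lerDl; apply: sumr_ge0 => e' _; exact: divr_ge0.
lra.
Qed.

Lemma verticesP y : vertices P y <->
  P y /\ forall x, P x -> supp x \subset supp y -> x = y.
Proof.
split=> [[Py Vy]|[Py uniq_y]]; split=> //.
  move=> x Px sxy; apply: contrapT => nxy; apply: Vy.
  have [[cy wy y0] [cx wx x0]] := (Py, Px).
  have [r /andP[r0 r1] yx0] := nonneg_perturb x0 y0 sxy.
  have r10 : 1 - r != 0 by rewrite subr_eq0 eq_sym lt_eqF.
  (* Extrapolate from [x] beyond [y]: the point [v] is in [P], and [y] is strictly between [x] and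
     [v]. The null term gives the form expected by the [_lin] lemmas. *)
  pose v := (1 - r)^-1 *: (1 *: y + (- r) *: x) + 0 *: y.
  have vE : y = r *: x + (1 - r) *: v.
    by rewrite /v scale0r addr0 scalerA divff// !scale1r scaleNr addrC subrK.
  exists x, v, r; split=> //; last by rewrite r0.
  split; last first.
    move=> vy; apply: nxy; move: vE; rewrite vy scalerBl scale1r addrCA.
    move/eqP; rewrite -subr_eq0 opprD addrA subrr sub0r oppr_eq0 -scalerBr.
    by rewrite scaler_eq0 (gt_eqF r0) subr_eq0 => /eqP.
  split.
  - by do !apply: circulation_lin.
  - have := weight_lin r (1 - r) x v; rewrite -vE => wE.
    have : (1 - r) * weight v = (1 - r) * (-1).
      by move: wE; rewrite [weight y]wy [weight x]wx; lra.
    by move/(mulfI r10).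
  - by apply: nonneg_lin => //; rewrite invr_ge0; lra.
case=> v1 [v2 [l [[Pv1 v1y] [Pv2 _] /andP[l0 l1] yE]]]; apply: v1y.
apply: uniq_y => //; rewrite yE; have [[_ _ v10] [_ _ v20]] := (Pv1, Pv2).
by apply: supp_summand => //; lra.
Qed.

(** A direction is the difference of two points of [P], which gives the linear equations; a negative
    coordinate would lead out of the orthant along a long enough step. *)
Lemma directionP d : P !=set0 -> is_direction P d <-> recession_cone d.
Proof.
case=> x Px; have [cx wx x0] := Px; split=> [dird|[cd wd d0] y m [cy wy y0] m0].
  have [cxd wxd _] := dird x 1 Px ler01.
  have dE : d = 1 *: (x + 1 *: d) + (-1) *: x.
    by rewrite !scale1r scaleN1r addrAC subrr add0r.
  split=> [||e].
  - by rewrite dE; exact: circulation_lin.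
  - by rewrite dE weight_lin [weight x]wx [weight _]wxd; lra.
  rewrite leNgt; apply/negP => de.
  (* This step length brings coordinate [e] to -1. *)
  have m0 : 0 <= (x e + 1) / - d e by rewrite divr_ge0// ?addr_ge0// oppr_ge0 ltW.
  have [_ _ /(_ e)] := dird x _ Px m0.
  rewrite !ffunE /GRing.scale /= invrN mulrN mulNr divfK ?lt_eqF//; lra.
have ymE : y + m *: d = 1 *: y + m *: d by rewrite scale1r.
rewrite ymE; split.
- exact: circulation_lin.
- by have := weight_lin 1 m y d; rewrite wd [weight y]wy /weight => ->; lra.
- exact: nonneg_lin.
Qed.

(** In the plane spanned by independent [x] and [y], proportionality forces the determinant of the
    coefficients to vanish. *)
Lemma not_proportional_comb (U : lmodType R) (x y : U) (a b a' b' : R) :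
  (forall s t : R, s *: x + t *: y = 0 -> s = 0 /\ t = 0) ->
  a * b' != b * a' -> ~ proportional (a *: x + b *: y) (a' *: x + b' *: y).
Proof.
move=> indep /eqP ne.
have coef (s t s' t' : R) k :
    s *: x + t *: y = k *: (s' *: x + t' *: y) -> s = k * s' /\ t = k * t'.
  move=> /eqP; rewrite -subr_eq0 scalerDr !scalerA opprD addrACA -!scalerBl.
  by move/eqP/indep => [/eqP + /eqP]; rewrite !subr_eq0 => /eqP ? /eqP ?.
by case=> k [/coef[h1 h2]|/coef[h1 h2]]; apply: ne; rewrite h1 h2; lra.
Qed.

Lemma extreme_directionsP d : P !=set0 -> extreme_directions P d <->
  [/\ recession_cone d, d <> 0
    & forall z, recession_cone z -> supp z \subset supp d -> exists t : R, z = t *: d].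
Proof.
move=> PN0; split=> [[/(directionP _ PN0) cd d0 Ed]|[cd d0 dmin]]; split=> //.
- move=> z cz szd; apply: contrapT => nzd; apply: Ed.
  have [[dc wd dp] [zc wz zp]] := (cd, cz).
  have [r /andP[r0 r1] drz] := nonneg_perturb zp dp szd.
  have indep (s t : R) : s *: z + t *: d = 0 -> s = 0 /\ t = 0.
    have [-> /eqP|s0 /eqP] := eqVneq s 0.
      by rewrite scale0r add0r scaler_eq0 => /orP[/eqP|/eqP].
    rewrite addr_eq0 => /eqP sz; case: nzd; exists (- (s^-1 * t)).
    by rewrite scaleNr -scalerA -scalerN -sz scalerA mulVf// scale1r.
  (* Then [d] is the conic combination [r *: z + 1 *: d'], and [z], [d], [d'] are pairwise
     non-proportional by their coordinates on [z] and [d]. *)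
  pose d' := (- r) *: z + 1 *: d.
  have zE : z = 1 *: z + 0 *: d by rewrite scale1r scale0r addr0.
  have dE : d = 0 *: z + 1 *: d by rewrite scale1r scale0r add0r.
  exists z, d', r, 1; split=> //.
  + split; apply/directionP => //; split.
    * exact: circulation_lin.
    * by rewrite weight_lin wd wz; lra.
    * by rewrite /d' addrC.
  + have np := not_proportional_comb indep; split.
    * by have := np 1 0 0 1; rewrite -zE -dE; apply; apply/eqP; lra.
    * by have := np (- r) 1 0 1; rewrite -dE; apply; apply/eqP; lra.
    * by have := np 1 0 (- r) 1; rewrite -zE; apply; apply/eqP; lra.
  + exact: ltW.
  + by rewrite /d' !scale1r scaleNr addrA subrr add0r.
- exact/directionP.
- case=> d1 [d2 [a [b [[/(directionP _ PN0) c1 /(directionP _ PN0) c2]]]]].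
  move=> [n1 n2 _] a0 b0 dE.
  (* If [a] is 0 then [d] is a multiple of [d2]; otherwise the support of [d1] lies in that of [d],
     so [d1] is a multiple of [d]. *)
  have [a00|aN0] := eqVneq a 0.
    by apply: n2; exists b; right; rewrite dE a00 scale0r add0r.
  apply: n1; have [|t ->] := dmin d1 c1; last by exists t; left.
  rewrite dE; have [[_ _ p1] [_ _ p2]] := (c1, c2).
  by apply: supp_summand => //; rewrite lt_def aN0.
Qed.

(** * Signs of the cycles in a support *)

Lemma weight_decomposition y : circulation y -> nonneg y ->
  exists c : {set darc E} -> R,
    [/\ forall C, 0 <= c C, forall C, c C != 0 -> is_cycle C /\ C \subset supp y,
        y = \sum_C c C *: chi R C & weight y = \sum_C c C * arcs_weight w C].
Proof.
move=> cy y0; have [c [c0 cs yE]] := cycle_decomposition cy y0.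
exists c; split=> //; under eq_bigr do rewrite -weight_chi /weight mulr_sumr.
rewrite exchange_big /weight; apply: eq_bigr => e _.
rewrite [in LHS]yE sum_ffunE mulr_sumr; apply: eq_bigr => C _.
by rewrite !ffunE /GRing.scale /=; lra.
Qed.

Lemma neg_cycle_in_support y : circulation y -> nonneg y -> weight y < 0 ->
  exists2 C, neg_cycle w C & C \subset supp y.
Proof.
move=> cy y0; have [c [c0 cs _ ->]] := weight_decomposition cy y0.
apply: contraPP => noneg; apply/negP; rewrite -leNgt; apply: sumr_ge0 => C _.
have [->|cC] := eqVneq (c C) 0; first by rewrite mul0r.
apply: mulr_ge0 => //; rewrite leNgt; apply/negP => wC; apply: noneg.
by have [? ?] := cs C cC; exists C.
Qed.

(** Otherwise every term of a decomposition of [y] would have positive weight. Applied to an extreme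
    direction with [w] and with [- w], this gives cycles of both signs. *)
Lemma neg_cycle_or_zero_in_support y : circulation y -> nonneg y ->
  y <> 0 -> weight y <= 0 ->
  exists C, [/\ is_cycle C, C \subset supp y & arcs_weight w C <= 0].
Proof.
move=> cy y0 yN0; have [c [c0 cs yE ->]] := weight_decomposition cy y0.
apply: contraPP => nopos; apply/negP; rewrite -ltNge.
have term C : c C != 0 -> 0 < c C * arcs_weight w C.
  move=> cC; rewrite mulr_gt0 ?lt_def ?cC ?c0// -lt_def ltNge; apply/negP => wC.
  by apply: nopos; have [? ?] := cs C cC; exists C.
have [C cC] : exists C, c C != 0.
  apply: contrapT => nC; apply: yN0; rewrite yE big1// => C _.
  by have [->|cC] := eqVneq (c C) 0; [rewrite scale0r|case: nC; exists C].
rewrite (bigD1 C)//= ltr_pwDl ?term//; apply: sumr_ge0 => C' _.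
have [->|cC'] := eqVneq (c C') 0; first by rewrite mul0r.
exact/ltW/term.
Qed.

End Circulations.

(** * Points and cone vectors built from cycles *)

Section TwoCycles.
Variables (R : realType) (V : finType) (E : {set V * V}) (w : darc E -> R).
Local Notation vec := {ffun darc E -> R^o}.
Local Notation P := (neg_cycle_polyhedron w).
Implicit Types (x y z d : vec) (A B C D : {set darc E}) (e : darc E).

Lemma arcs_weightN C : arcs_weight (fun e => - w e) C = - arcs_weight w C.
Proof. by rewrite /arcs_weight sumrN. Qed.

Lemma chi_neq0 C : is_cycle C -> chi R C <> 0.
Proof.
move=> cC C0; have /eqP := cycle_neq0 R cC; apply.
by rewrite -(supp_chi R C) C0; apply/setP => e; rewrite !inE ffunE eqxx.
Qed.

(* According to the signs of [b] and [c], one of the cycles is included in    *)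
(* another one, and distinct cycles are incomparable.                         *)
Lemma cycles_independent (A B D : {set darc E}) (a b c : R) :
  is_cycle A -> is_cycle B -> is_cycle D -> 0 < a ->
  a *: chi R A = b *: chi R B + c *: chi R D -> A = B \/ A = D.
Proof.
move=> cA cB cD a0 /ffunP abc.
have {}abc e : a * (e \in A)%:R = b * (e \in B)%:R + c * (e \in D)%:R.
  by have := abc e; rewrite !ffunE.
have [b0|b0] := ltP 0 b; last first.
  right; apply: (cycle_subset_eq R) => //; apply/fintype.subsetP => e eA.
  by have := abc e; rewrite eA; case: (e \in D) => //; case: (e \in B) => /=; lra.
left; have [c0|c0] := leP 0 c.
  apply/esym/(cycle_subset_eq R) => //; apply/fintype.subsetP => e eB.
  by have := abc e; rewrite eB; case: (e \in A) => //; case: (e \in D) => /=; lra.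
apply: (cycle_subset_eq R) => //; apply/fintype.subsetP => e eA.
by have := abc e; rewrite eA; case: (e \in B) => //; case: (e \in D) => /=; lra.
Qed.

Lemma vertex_of_neg_cycle C : neg_cycle w C ->
  P ((-1 / arcs_weight w C) *: chi R C).
Proof.
move=> [cC wC]; set t := _ / _.
have -> : t *: chi R C = t *: chi R C + 0 *: chi R C.
  by rewrite scale0r addr0.
split.
- by apply: circulation_lin; exact: circulation_chi.
- have := weight_lin w t 0 (chi R C) (chi R C).
  by rewrite !weight_chi /weight => ->; rewrite mul0r addr0 divfK// lt_eqF.
- apply: nonneg_lin => //; try exact: chi_ge0.
  by rewrite /t mulN1r oppr_ge0 invr_le0 ltW.
Qed.

Lemma cone_zero_cycle C : zero_cycle w C -> recession_cone w (chi R C).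
Proof.
move=> [cC wC]; split; [exact: circulation_chi| |exact: chi_ge0].
by rewrite weight_chi.
Qed.

(** The crossed weights make the total weight vanish. This is the element of [D2] before
    normalization. *)
Definition balanced C1 C2 : vec :=
  arcs_weight w C2 *: chi R C1 + (- arcs_weight w C1) *: chi R C2.

Section Balanced.
Variables C1 C2 : {set darc E}.
Hypotheses (n1 : neg_cycle w C1) (p2 : pos_cycle w C2).

Lemma balanced_cone : recession_cone w (balanced C1 C2).
Proof.
have [[c1 w1] [c2 w2]] := (n1, p2); split.
- by apply: circulation_lin; exact: circulation_chi.
- by rewrite weight_lin !weight_chi; lra.
- by apply: nonneg_lin; [lra|lra| |]; exact: chi_ge0.
Qed.

Lemma balanced_neq0 : balanced C1 C2 <> 0.
Proof.
have [[c1 w1] [c2 w2]] := (n1, p2) => b0.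
have /set0Pn[e] := cycle_neq0 R c1; rewrite -(supp_chi R C1).
move=> /(fintype.subsetP (supp_summand w2 _ (@chi_ge0 _ _ _ _) (@chi_ge0 _ _ _ C2))).
move/(_ (- arcs_weight w C1)); rewrite oppr_ge0 => /(_ (ltW w1)).
by rewrite -/(balanced C1 C2) b0 inE ffunE eqxx.
Qed.

Lemma supp_balanced : supp (balanced C1 C2) \subset C1 :|: C2.
Proof.
apply/fintype.subsetP => e; rewrite !inE !ffunE; apply: contraNT.
by rewrite negb_or => /andP[/negPf -> /negPf ->]; rewrite !scaler0 addr0.
Qed.

End Balanced.

(** * Normalization *)

Lemma normalizeZ (t : R) x : t != 0 -> normalize (t *: x) = normalize x.
Proof.
move=> t0; rewrite /normalize; under eq_bigr do rewrite ffunE.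
by rewrite -scaler_sumr scalerA /GRing.scale /= invfM mulrC mulrA divff// mul1r.
Qed.

Lemma sum_chi C : \sum_e chi R C e = #|C|%:R :> R.
Proof.
under eq_bigr do rewrite ffunE.
by rewrite -natr_sum -big_mkcond /= sum1_card.
Qed.

Lemma normalize_chi C : normalize (chi R C) = (#|C|%:R)^-1 *: chi R C.
Proof. by rewrite /normalize sum_chi. Qed.

Lemma normalize_balanced C1 C2 : normalize (balanced C1 C2) =
  mu1 w C1 C2 *: chi R C1 + mu2 w C1 C2 *: chi R C2.
Proof.
rewrite /normalize /mu1 /mu2 scalerDr !scalerA.
have -> : \sum_e balanced C1 C2 e =
    arcs_weight w C2 * #|C1|%:R - arcs_weight w C1 * #|C2|%:R :> R.
  rewrite -!sum_chi !mulr_sumr -sumrB; apply: eq_bigr => e _.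
  by rewrite !ffunE /GRing.scale /= mulNr.
by congr (_ *: _ + _ *: _); rewrite mulrC.
Qed.

Lemma mu_ge0 C1 C2 : two_cycle w C1 C2 -> 0 <= mu1 w C1 C2 /\ 0 <= mu2 w C1 C2.
Proof.
move=> [[_ w1] [_ w2] _]; rewrite /mu1 /mu2.
have den : 0 <= arcs_weight w C2 * #|C1|%:R - arcs_weight w C1 * #|C2|%:R.
  by rewrite addr_ge0// -?mulNr mulr_ge0// ?oppr_ge0 ltW.
by split; rewrite divr_ge0// ?oppr_ge0 ltW.
Qed.

(** * Vertices and extreme directions in terms of cycles *)

Lemma verticesE :
  vertices P = [set (-1 / arcs_weight w C) *: chi R C | C in neg_cycle w].
Proof.
apply/seteqP; split=> [y /verticesP[Py ymin]|_ [C nC <-]].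
  have [cy wy y0] := Py.
  have [|C nC sC] := neg_cycle_in_support (w := w) cy y0.
    by rewrite [weight _ _]wy; lra.
  exists C => //; apply: ymin; first exact: vertex_of_neg_cycle.
  have [_ wC] := nC; rewrite suppZ ?supp_chi// mulf_neq0 ?invr_neq0 ?lt_eqF//.
  lra.
apply/verticesP; split; first exact: vertex_of_neg_cycle.
move=> z [cz wz z0]; have [cC wC] := nC.
rewrite suppZ ?supp_chi; last by rewrite mulf_neq0 ?invr_neq0 ?lt_eqF//; lra.
(* The weight -1 then determines the factor [t]. *)
move=> /(circulation_on_cycle cC cz)[t zE].
rewrite {1}zE; congr (_ *: _).
have := wz; have /= := weight_lin w t 0 (chi R C) (chi R C).
rewrite scale0r addr0 -zE weight_chi mul0r addr0 /weight => -> <-.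
by rewrite mulfK// lt_eqF.
Qed.

Lemma extreme_zero_cycle C : P !=set0 -> zero_cycle w C ->
  extreme_directions P (chi R C).
Proof.
move=> PN0 zC; have [cC _] := zC; apply/extreme_directionsP => //; split.
- exact: cone_zero_cycle.
- exact: chi_neq0.
- by move=> z [cz _ _]; rewrite supp_chi; exact: circulation_on_cycle.
Qed.

Lemma extreme_two_cycle C1 C2 : P !=set0 -> two_cycle w C1 C2 ->
  extreme_directions P (balanced C1 C2).
Proof.
move=> PN0 [n1 p2 only]; apply/extreme_directionsP => //; split.
- exact: balanced_cone.
- exact: balanced_neq0.
have [[c1 w1] [c2 w2]] := (n1, p2).
move=> z [cz wz z0] sz.
have [c [_ cs zE wzE]] := weight_decomposition w cz z0.
have C12 : C2 != C1 by apply: contraTneq w2 => ->; rewrite -leNgt ltW.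
(* By the 2-cycle condition only [C1] and [C2] occur in the decomposition of [z]; weight 0 then
   fixes the ratio of their coefficients. *)
have c_other C : C != C1 -> C != C2 -> c C = 0.
  move=> /eqP n1' /eqP n2'; apply/eqP; apply: contrapT => /negP /cs[cC sC].
  have sC12 : C \subset C1 :|: C2.
    by apply: fintype.subset_trans sC _; apply: fintype.subset_trans sz (supp_balanced _ _).
  by case: (only C cC sC12).
have {}zE : z = c C1 *: chi R C1 + c C2 *: chi R C2.
  rewrite zE (bigD1 C1)//= (bigD1 C2)//= big1 ?addr0// => C /andP[h1 h2].
  by rewrite c_other// scale0r.
have {}wzE : c C1 * arcs_weight w C1 + c C2 * arcs_weight w C2 = 0.
  rewrite -wz wzE [RHS](bigD1 C1)//= [in RHS](bigD1 C2)//= big1 ?addr0//.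
  by move=> C /andP[h1 h2]; rewrite c_other// mul0r.
have w20 : arcs_weight w C2 != 0 by rewrite gt_eqF.
exists (c C1 / arcs_weight w C2).
rewrite zE scalerDr !scalerA divfK//; congr (_ + _ *: _).
by apply: (mulIf w20); rewrite mulrAC divfK//; lra.
Qed.

Lemma extreme_direction_cycles d : P !=set0 -> extreme_directions P d ->
  (D1 w `|` D2 w) (normalize d).
Proof.
move=> PN0 /(extreme_directionsP _ PN0)[[cd wd dp] d0 dmin].
have normE x : recession_cone w x -> x <> 0 -> supp x \subset supp d ->
    normalize d = normalize x.
  move=> cx x0 /(dmin _ cx)[t xE]; rewrite xE normalizeZ//.
  by apply: contra_notN x0 => /eqP t0; rewrite xE t0 scale0r.
have [[C [zC sC]]|nozero] :=
    pselect (exists C, zero_cycle w C /\ C \subset supp d).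
  have [cC _] := zC.
  left; exists C => //; rewrite -normalize_chi; apply/esym/normE.
  - exact: cone_zero_cycle.
  - exact: chi_neq0.
  - by rewrite supp_chi.
have nonzero C : is_cycle C -> C \subset supp d -> arcs_weight w C != 0.
  by move=> cC sC; apply/eqP => wC; apply: nozero; exists C.
have [|C1 [c1 s1]] := neg_cycle_or_zero_in_support (w := w) cd dp d0.
  by rewrite wd.
rewrite le_eqVlt (negPf (nonzero _ c1 s1)) => w1.
have [|C2 [c2 s2]] := neg_cycle_or_zero_in_support (w := fun e => - w e) cd dp d0.
  rewrite /weight; under eq_bigr do rewrite mulNr.
  by rewrite sumrN oppr_le0 -/(weight w d) wd.
rewrite arcs_weightN oppr_le0 le_eqVlt eq_sym (negPf (nonzero _ c2 s2)) => w2.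
have sb C C' : C \subset supp d -> C' \subset supp d ->
    supp (balanced C C') \subset supp d.
  move=> sC sC'; apply: fintype.subset_trans (supp_balanced _ _) _.
  by rewrite finset.subUset sC.
(* [balanced C1 C2] is a nonzero multiple of [d], so it can replace [d] as generator of the ray. *)
have mult x : recession_cone w x -> supp x \subset supp d ->
    exists t : R, x = t *: balanced C1 C2.
  move=> cx sx; have [t ->] := dmin x cx sx.
  have [|s bE] := dmin (balanced C1 C2) _ (sb _ _ s1 s2).
    exact: balanced_cone.
  have s0 : s != 0.
    by apply/eqP => s0; apply: (@balanced_neq0 C1 C2) => //; rewrite bE s0 scale0r.
  by exists (t / s); rewrite bE scalerA divfK.
right; exists C1, C2; rewrite -normalize_balanced; split; last first.
  by apply: normE; [exact: balanced_cone|exact: balanced_neq0|exact: sb].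
split=> // C cC sC12.
have sC : C \subset supp d.
  by apply: fintype.subset_trans sC12 _; rewrite finset.subUset s1.
(* A cycle [C] in the union is balanced against [C1] if positive, against [C2] if negative.
   Comparing the result with [balanced C1 C2] and solving for [chi R C], whose coefficient is
   positive, gives a relation between three cycles. *)
have [wC|wC|/eqP] := ltgtP (arcs_weight w C) 0; last first.
- by rewrite (negPf (nonzero _ cC sC)).
- have [|t] := mult (balanced C1 C) _ (sb _ _ s1 sC); first exact: balanced_cone.
  rewrite /balanced scalerDr !scalerA => bE.
  apply: (cycles_independent (a := - arcs_weight w C1)
    (b := t * arcs_weight w C2 - arcs_weight w C) (c := t * - arcs_weight w C1)) => //.
    by rewrite oppr_gt0.
  by rewrite scalerBl addrAC -bE addrAC subrr add0r.
- have [|t] := mult (balanced C C2) _ (sb _ _ sC s2); first exact: balanced_cone.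
  rewrite /balanced scalerDr !scalerA => bE.
  apply: (cycles_independent (a := arcs_weight w C2)
    (b := t * arcs_weight w C2) (c := t * - arcs_weight w C1 + arcs_weight w C)) => //.
  by rewrite scalerDl addrA -bE -addrA -scalerDl addNr scale0r addr0.
Qed.

End TwoCycles.

Theorem theorem1 (R : realType) (V : finType) (E : {set V * V})
    (w : darc E -> R) :
  [/\ vertices (neg_cycle_polyhedron w) =
        [set (-1 / arcs_weight w C) *: chi R C | C in neg_cycle w],
      neg_cycle_polyhedron w !=set0 ->
        [set normalize d | d in extreme_directions (neg_cycle_polyhedron w)]
        = D1 w `|` D2 w
    & forall C1 C2, two_cycle w C1 C2 ->
        0 <= mu1 w C1 C2 /\ 0 <= mu2 w C1 C2].
Proof.
split=> [|PN0|C1 C2]; [exact: verticesE| |exact: mu_ge0].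
apply/seteqP; split=> [_ [d dE <-]|_ [[C zC <-]|[C1 [C2 [tC ->]]]]].
- exact: extreme_direction_cycles.
- by exists (chi R C); [exact: extreme_zero_cycle|exact: normalize_chi].
- exists (balanced w C1 C2); [exact: extreme_two_cycle|exact: normalize_balanced].
Qed.
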